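(* Suppose $G$ is a compactly generated totally disconnected locally compact group. Suppose further that $G$ is amenable and non-unimodular. Then $\mathrm{F\o l}^\ast G=0$ if and only if the image of $G$ under the modular homomorphism $\Delta_G$ is dense in $\mathbb{R}^*_+$.
   Context: Let $\mu$ be a (left) Haar measure on a locally compact group $G$. The modular homomorphism $\Delta_G:G\to\mathbb{R}^*_+$ (positive reals under multiplication) is defined by $\mu(Ag)=\Delta_G(g)\mu(A)$ for all Borel $A\subseteq G$ and $g\in G$; $G$ is unimodular if $\Delta_G\equiv 1$. $G$ is amenable if for every compact $K\subseteq G$ and every $\varepsilon>0$ there is a compact set $U\subseteq G$ of positive measure with $\mu(KU)/\mu(U)\le 1+\varepsilon$. For $G$ compactly generated, \[ \mathrm{F\o l}^\ast G=\inf_S\inf_U\frac{\mu(US\setminus U)}{\mu(U)}, \] where the infima are over all compact symmetric generating sets $S$ for $G$ and all compact subsets $U\subseteq G$ of positive measure. *)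

(* Defs.v *)
From HB Require Import structures.
From mathcomp Require Import all_boot all_order all_algebra.
From mathcomp Require Import all_classical all_reals all_analysis.
Import Order.TTheory GRing.Theory Num.Theory.
Import numFieldNormedType.Exports.

Set Implicit Arguments.
Unset Strict Implicit.
Unset Printing Implicit Defensive.

Local Open Scope classical_set_scope.
Local Open Scope ring_scope.

HB.structure Definition PreTopologicalGroup :=
  {G of PointedTopological G & Group G}.

HB.mixin Record PreTopologicalGroup_isTopologicalGroup G
    & PreTopologicalGroup G := {
  mulg_continuous : continuous (fun x : G * G => (x.1 * x.2)%g) ;
  invg_continuous : continuous (fun x : G => (x^-1)%g) ;
}.

(* The base point carried by a pointed type plays no role; it is required by
   the construction of the Borel measurable space, and costs no generality
   since a group is nonempty. *)
#[short(type="topologicalGroupType")]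
HB.structure Definition TopologicalGroup :=
  {G of PreTopologicalGroup G & PreTopologicalGroup_isTopologicalGroup G}.

Definition set_mulg (G : topologicalGroupType) (A B : set G) : set G :=
  [set (a * b)%g | a in A & b in B].

Definition generating (G : topologicalGroupType) (S : set G) : Prop :=
  smallest (fun H : set G => group_closed (mem H)) S = [set: G].

Definition symmetric_set (G : topologicalGroupType) (S : set G) : Prop :=
  [set (x^-1)%g | x in S] = S.

Definition compactly_generated (G : topologicalGroupType) : Prop :=
  exists2 K : set G, compact K & generating K.

Notation borel G := (g_sigma_algebraType (@open G)).

(* Left Haar measures are taken to be Radon measures: without the two
   regularity conditions uniqueness up to scaling may fail when G is not second
   countable. *)
Record left_haar (R : realType) (G : topologicalGroupType)
    (mu : {measure set (borel G) -> \bar R}) : Prop := LeftHaar {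
  haar_neq0 : mu [set: borel G] <> 0%E ;
  haar_compact_fin : forall K : set G, compact K -> (mu K < +oo)%E ;
  haar_left_invariant : forall (g : G) (A : set (borel G)),
    measurable A -> mu (set_mulg [set g] A) = mu A ;
  haar_outer_regular : forall A : set (borel G), measurable A ->
    mu A = ereal_inf [set mu U | U in [set U : set G | open U /\ A `<=` U]] ;
  haar_inner_regular : forall U : set G, open U ->
    mu U = ereal_sup [set mu K | K in [set K : set G | compact K /\ K `<=` U]]
}.

(* The multiplicative group of positive reals, with the topology induced by
   that of R (the library's topology on set_type). *)
Notation Rpos R := (set_type [set x : R | 0 < x]).

Definition modular_function (R : realType) (G : topologicalGroupType)
    (mu : {measure set (borel G) -> \bar R}) (Delta : G -> Rpos R) : Prop :=
  forall (g : G) (A : set (borel G)), measurable A ->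
    mu (set_mulg A [set g]) = ((\val (Delta g))%:E * mu A)%E.

Definition unimodular (R : realType) (G : topologicalGroupType)
    (Delta : G -> Rpos R) : Prop :=
  forall g : G, \val (Delta g) = 1.

Definition amenable (R : realType) (G : topologicalGroupType)
    (mu : {measure set (borel G) -> \bar R}) : Prop :=
  forall K : set G, compact K -> forall eps : R, 0 < eps ->
    exists U : set G, [/\ compact U, (0 < mu U)%E &
      (mu (set_mulg K U) / mu U <= (1 + eps)%:E)%E].

Definition folner_constant (R : realType) (G : topologicalGroupType)
    (mu : {measure set (borel G) -> \bar R}) : \bar R :=
  ereal_inf [set
    ereal_inf [set (mu (set_mulg U S `\` U) / mu U)%E |
      U in [set U : set G | compact U /\ (0 < mu U)%E]] |
    S in [set S : set G | [/\ compact S, symmetric_set S & generating S]]].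

(* Main.v *)
Require Import Defs.
From mathcomp Require Import all_boot all_order all_algebra.
From mathcomp Require Import all_classical all_reals all_analysis.
From mathcomp Require Import lra ring.
Import Order.TTheory GRing.Theory Num.Theory.
Import numFieldNormedType.Exports.
Local Open Scope classical_set_scope.
Local Open Scope ring_scope.

(** Why the theorem holds.

If [U] is compact and [s] lies in the generating set [S], then [Us] is contained
in [US], so [mu (US \ U) >= mu (Us) - mu U = (Delta s - 1) mu U]
([modular_boundary]). Every symmetric generating set of a non-unimodular group
contains some [s] with [Delta s > 1]. A zero Folner constant therefore produces
values of [Delta] above [1] and arbitrarily close to [1], and the powers of such
values come close to every positive real ([small_modular_dense]).

Conversely, let the image of [Delta] be dense and fix [q > 1]. Multiplying the
elements of a compact generating set by suitable powers of one [h] with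
[1 < Delta h <= q] moves all their moduli into [[1, q]], so [G] has a compact
symmetric generating set [S] on which [Delta <= q] ([small_generating_set]).
Total disconnectedness provides a compact open subgroup [V]
([compact_open_subgroup]), and [S] can be taken bi-invariant under [V].

Amenability gives a compact [U0] with [mu (S U0)] close to [mu U0]. This is about
multiplication on the left; after inversion it says that [F = U0^-1 V] is almost
invariant on the right, but for the right Haar measure, which gives the coset
[xV] the weight [Delta(x)^-1 mu V]. To return to [mu], which gives all left
cosets the same weight, slice [F] along the level sets
[U_t = {x in F | t <= Delta(x)^-1}]. As right multiplication by [S] changes
[Delta] by a factor at most [q], the set [U_t S] lies in
[{x in FS | t <= q Delta(x)^-1}]. If every compact set satisfied
[mu (US) >= c mu U], then integrating over [t] (a finite layer-cake argument over
cosets, [layer_cake]) would give [c mu (V U0) <= q mu (S U0)]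
([growth_transfer]). For [q] and [mu (S U0) / mu U0] close enough to [1] this
contradicts [c > 1], so some level set has a relatively small boundary
([dense_folner_constant]). *)

Set Implicit Arguments.
Unset Strict Implicit.
Unset Printing Implicit Defensive.

Local Notation "A ^-1s" := [set (x^-1)%g | x in A] (at level 2).

(** * Existence of compact open subgroups *)

(** Otherwise the sets [A `\` O] generate a proper filter on [C], and a cluster
point of it would lie in every member of [D] but not in [O]. *)
Lemma closed_directed_sub (T : topologicalType) (C O : set T)
    (D : set (set T)) :
  compact C -> open O -> D C -> (forall A, D A -> closed A) ->
  (forall A B, D A -> D B -> D (A `&` B)) ->
  \bigcap_(A in D) A `<=` O -> exists2 A, D A & A `<=` O.
Proof.
move=> cC oO DC clD DI DO; apply: contrapT => nD.
have FF : ProperFilter (filter_from D (fun A => A `\` O)).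
  apply: filter_from_proper.
    apply: filter_from_filter; first by exists C.
    by move=> A B DA DB; exists (A `&` B); [exact: DI|move=> x [[]]].
  move=> A DA; apply/set0P/eqP; rewrite setD_eq0 => AO.
  by apply: nD; exists A.
have [|p [Cp clp]] := cC _ FF; first by exists C => // x [].
have mem A : D A -> (A `\` O) p.
  move=> DA; have : closed (A `\` O).
    by rewrite setDE; apply: closedI; [exact: clD|exact: open_closedC].
  by apply=> B Bp; apply: clp => //; exists A.
by have [_] := mem _ DC; apply; apply: DO => A /mem[].
Qed.

Section TopologicalGroup.
Context {G : topologicalGroupType}.
Implicit Types (A B C K O S V : set G) (g h x y : G).

Lemma mulgl_continuous g : continuous (fun x : G => (g * x)%g).
Proof.
move=> x; apply: (@continuous2_cvg _ _ _ _ _ _ (fun=> g) id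
  (fun x y : G => (x * y)%g)).
- exact: (@mulg_continuous G (g, x)).
- exact: cvg_cst.
- exact: cvg_id.
Qed.

Lemma mulgr_continuous g : continuous (fun x : G => (x * g)%g).
Proof.
move=> x; apply: (@continuous2_cvg _ _ _ _ _ _ id (fun=> g)
  (fun x y : G => (x * y)%g)).
- exact: (@mulg_continuous G (x, g)).
- exact: cvg_id.
- exact: cvg_cst.
Qed.

Lemma mulg_continuous2 x y O : open O -> O (x * y)%g ->
  \forall a \near x & b \near y, O (a * b)%g.
Proof.
move=> oO Oxy; apply: (@mulg_continuous G (x, y) O).
exact: open_nbhs_nbhs.
Qed.

(** Compactness of [A `*` B] provides neighbourhoods [W1], [W2] of the identity
with [A W1] and [B W2] disjoint. *)
Lemma compact_separation A B : hausdorff_space G -> compact A -> compact B ->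
  A `&` B = set0 -> exists A' B', [/\ open A', open B', A `<=` A', B `<=` B' &
    A' `&` B' = set0].
Proof.
move=> hG cA cB AB0.
have /compact_near_coveringP := compact_setX cA cB.
move=> /(_ _ (nbhs ((1, 1)%g : G * G))
  (fun w p => (p.1 * w.1)%g <> (p.2 * w.2)%g) _).
case.
  move=> [a b] [/= Aa Bb].
  have : ~ cluster (nbhs a) b.
    move=> /hG ab; suff : set0 b by [].
    by rewrite -AB0; split=> //; rewrite -ab.
  move=> /existsNP[P /existsNP[Q /not_implyP[aP /not_implyP[bQ PQ]]]].
  have aP1 : nbhs (a * 1)%g P by rewrite mulg1.
  have bQ1 : nbhs (b * 1)%g Q by rewrite mulg1.
  have [[U1 W1] /= [aU1 W11] UW1] := @mulg_continuous G (a, 1%g) P aP1.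
  have [[U2 W2] /= [bU2 W21] UW2] := @mulg_continuous G (b, 1%g) Q bQ1.
  exists (U1 `*` U2, W1 `*` W2) => /=.
    split; first by exists (U1, U2).
    by exists (W1, W2).
  move=> [[x y] [w v]] /= [[Ux Uy] [Ww Wv]] xy; apply: PQ; exists (x * w)%g.
  split; first exact: (UW1 (x, w)).
  by rewrite xy; exact: (UW2 (y, v)).
move=> [W1 W2] /= [W11 W21] sep.
exists (\bigcup_(a in A) ((fun x => a^-1 * x)%g @^-1` W1°)).
exists (\bigcup_(a in B) ((fun x => a^-1 * x)%g @^-1` W2°)); split.
- apply: bigcup_open => a _; apply: open_comp; last exact: open_interior.
  by move=> x _; exact: mulgl_continuous.
- apply: bigcup_open => a _; apply: open_comp; last exact: open_interior.
  by move=> x _; exact: mulgl_continuous.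
- by move=> a Aa; exists a => //=; rewrite mulVg.
- by move=> a Aa; exists a => //=; rewrite mulVg.
- apply/seteqP; split => // x.
  move=> [[a Aa /= /interior_subset W1a] [b Bb /= /interior_subset W2b]].
  apply: (sep (a^-1 * x, b^-1 * x)%g _ (a, b)) => //=.
  by rewrite !mulVKg.
Qed.

(** The relatively clopen neighbourhoods of [x] in [C]; their intersection is the
quasi-component of [x] in [C]. *)
Definition rel_clopen_nbhs C x := [set A : set G |
  [/\ A x, closed A & exists2 O, open O & A = C `&` O]].

Lemma rel_clopen_nbhsI C x A B :
  rel_clopen_nbhs C x A -> rel_clopen_nbhs C x B ->
  rel_clopen_nbhs C x (A `&` B).
Proof.
move=> [Ax cA [ O oO AE]] [Bx cB [P oP BE]]; split => //; first exact: closedI.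
by exists (O `&` P); [exact: openI|rewrite AE BE setIACA setIid].
Qed.

(** In a compact Hausdorff space quasi-components are connected: if two disjoint
closed sets cover the quasi-component, separate them by open sets; by compactness
some relatively clopen neighbourhood of [x] is already covered by these two open
sets, and its trace on the one containing [x] is again relatively clopen. *)
Lemma quasi_component_set1 C x :
  hausdorff_space G -> totally_disconnected [set: G] ->
  compact C -> C x -> \bigcap_(A in rel_clopen_nbhs C x) A = [set x].
Proof.
move=> hG tdG cC Cx; set Q := \bigcap_(_ in _) _.
have Qx : Q x by move=> A [].
have clC : closed C by exact: compact_closed.
have DC : rel_clopen_nbhs C x C.
  by split=> //; exists setT; [exact: openT|rewrite setIT].
have clQ : closed Q by apply: closed_bigI => A [].
have cQ : compact Q.
  by apply: (subclosed_compact clQ cC) => y; exact.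
have split_trivial E F : closed E -> closed F -> E `&` F = set0 ->
    Q = E `|` F -> E x -> F = set0.
  move=> cE cF EF0 QEF Ex.
  have [| |E' [F' [oE' oF' EE' FF' EF'0]]] :=
    @compact_separation E F hG _ _ EF0.
  - by apply: (subclosed_compact cE cQ) => y; rewrite QEF; left.
  - by apply: (subclosed_compact cF cQ) => y; rewrite QEF; right.
  have [| | | | | A [Ax cA [ O oO AE]] AEF] :=
    @closed_directed_sub _ C (E' `|` F') (rel_clopen_nbhs C x) cC.
  - exact: openU.
  - exact: DC.
  - by move=> A [].
  - exact: rel_clopen_nbhsI.
  - by rewrite -/Q QEF; exact: setUSS.
  have AE' : A `&` E' = A `&` ~` F'.
    apply/seteqP; split => y [Ay Ey]; split => //.
      by move=> Fy; suff : set0 y by []; rewrite -EF'0.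
    by have [//|Fy] := AEF _ Ay.
  have DAE : rel_clopen_nbhs C x (A `&` E').
    split; first by split=> //; exact: EE'.
      by rewrite AE'; apply: closedI => //; exact: open_closedC.
    by exists (O `&` E'); [exact: openI|rewrite AE setIA].
  apply/seteqP; split => // y Fy.
  have Qy : Q y by rewrite QEF; right.
  have [_ Ey] := Qy _ DAE.
  by rewrite -EF'0; split => //; exact: FF'.
have conQ : connected Q.
  move=> B B0 [ O oO BO] [Z cZ BZ].
  have clB : closed B by rewrite BZ; exact: closedI.
  have clB' : closed (Q `&` ~` O) by apply: closedI => //; exact: open_closedC.
  have BB0 : B `&` (Q `&` ~` O) = set0.
    by rewrite BO; apply/seteqP; split => // y [[_ ?] []].
  have QBB : Q = B `|` (Q `&` ~` O) by rewrite BO -setIUr setUv setIT.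
  have [Bx|nBx] := pselect (B x).
    by rewrite [RHS]QBB (split_trivial _ _ clB clB' BB0 QBB Bx) setU0.
  move: B0 => [b]; rewrite (split_trivial _ _ clB' clB) //.
  - by rewrite setIC.
  - by rewrite setUC.
  - by split => // Ox; apply: nBx; rewrite BO.
apply/seteqP; split; last by move=> _ ->.
rewrite -(tdG x I) => y Qy.
by exists Q.
Qed.

(** As the relatively clopen neighbourhoods of [x] shrink to [x], one of them lies
in the interior of [C], and is then open in the whole group. *)
Lemma compact_open_nbhs C x :
  hausdorff_space G -> totally_disconnected [set: G] ->
  compact C -> nbhs x C -> exists2 A, compact A & open A /\ A x.
Proof.
move=> hG tdG cC /nbhs_interior xC.
have Cx : C° x by exact: nbhs_singleton.
have [||||| A [Ax cA [ O oO AE]] AC] :=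
  @closed_directed_sub _ C C° (rel_clopen_nbhs C x) cC.
- exact: open_interior.
- split; [exact: interior_subset|exact: compact_closed|].
  by exists setT; [exact: openT|rewrite setIT].
- by move=> A [].
- exact: rel_clopen_nbhsI.
- rewrite quasi_component_set1//; last exact: interior_subset.
  by move=> _ ->.
exists A.
  by apply: (subclosed_compact cA cC); rewrite AE; exact: subIsetl.
split=> //.
have -> : A = C° `&` O; last by apply: openI => //; exact: open_interior.
apply/seteqP; split => y.
  by move=> Ay; split; [exact: AC|move: Ay; rewrite AE => -[]].
by rewrite AE => -[/interior_subset].
Qed.

Lemma set_group_closed1 V : group_closed (mem V) -> V 1%g.
Proof. by case=> + _; rewrite in_setE. Qed.

Lemma set_group_closedV V x : group_closed (mem V) -> V x -> V (x^-1)%g.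
Proof. by move=> gV Vx; have /set_mem := group_closedV gV (mem_set Vx). Qed.

Lemma set_group_closedM V x y :
  group_closed (mem V) -> V x -> V y -> V (x * y)%g.
Proof.
by move=> gV Vx Vy; have /set_mem := group_closedM gV (mem_set Vx) (mem_set Vy).
Qed.

Lemma set_group_closedP V :
  V 1%g -> (forall x y, V x -> V y -> V (x * y^-1)%g) ->
  group_closed (mem V).
Proof.
move=> V1 VB; split; first exact: mem_set.
by move=> x y /set_mem Vx /set_mem Vy; apply/mem_set/VB.
Qed.

(** Van Dantzig's theorem. The subgroup is the right stabilizer of a compact open
neighbourhood [D] of [1]: compactness of [D] makes it a neighbourhood of [1], and
it is contained in [D] because [D] contains [1]. *)
Lemma compact_open_subgroup :
  hausdorff_space G -> totally_disconnected [set: G] ->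
  locally_compact [set: G] ->
  exists V, [/\ compact V, open V & group_closed (mem V)].
Proof.
move=> hG tdG lcG.
have [D cD [oD D1]] : exists2 A : set G, compact A & open A /\ A 1%g.
  have [C nC [cC _]] := lcG 1%g I.
  rewrite withinET in nC.
  exact: (compact_open_nbhs hG tdG cC).
pose V : set G := [set g | forall x, D x -> D (x * g)%g /\ D (x * g^-1)%g].
have gV : group_closed (mem V).
  apply: set_group_closedP; first by move=> x Dx; rewrite invg1 mulg1.
  move=> g h Vg Vh x Dx; rewrite invgM invgK !mulgA; split.
    by apply: (Vh _ _).2; apply: (Vg _ _).1.
  by apply: (Vg _ _).2; apply: (Vh _ _).1.
have VD : V `<=` D by move=> g /(_ _ D1)[]; rewrite mul1g.
have V1 : nbhs 1%g V.
  have /compact_near_coveringP := cD.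
  move=> /(_ _ (nbhs (1%g : G)) (fun g x => D (x * g)%g /\ D (x * g^-1)%g)
    (nbhs_filter _)) nc; apply: nc.
  move=> x Dx; have Dx1 : D (x * 1)%g by rewrite mulg1.
  have [[P Q] /= [xP Q1] PQ] := mulg_continuous2 oD Dx1.
  exists (P, Q `&` (fun g : G => g^-1)%g @^-1` Q) => /=.
    split=> //; apply: filterI => //.
    by apply: (@invg_continuous G 1%g Q); rewrite invg1.
  move=> [y g] /= [Py [Qg Qg']]; split.
    exact: (PQ (y, g)).
  exact: (PQ (y, g^-1%g)).
clearbody V.
have oV : open V.
  rewrite openE => g Vg; rewrite /interior.
  have V1' : nbhs (g^-1 * g)%g V by rewrite mulVg.
  have : \forall h \near g, V (g^-1 * h)%g by exact: mulgl_continuous V1'.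
  move=> nV; apply: (filterS _ nV) => h /= Vgh.
  by rewrite -(mulVKg g h); exact: set_group_closedM.
have clV : closed V.
  rewrite -(setCK V); apply: open_closedC; rewrite openE => g nVg.
  have V1' : nbhs (g^-1 * g)%g V by rewrite mulVg.
  have : \forall h \near g, V (g^-1 * h)%g by exact: mulgl_continuous V1'.
  move=> nV; apply: (filterS _ nV) => h /= Vgh Vh; apply: nVg.
  have -> : g = (h * (g^-1 * h)^-1)%g by rewrite invgM invgK mulVKg.
  by apply: set_group_closedM => //; exact: set_group_closedV.
exists V; split=> //.
exact: (subclosed_compact clV cD VD).
Qed.

(** * Products of sets, generation and coset transversals *)

Lemma generating_sub S V : generating S -> group_closed (mem V) -> S `<=` V ->
  V = [set: G].
Proof.
move=> gS gV SV; apply/seteqP; split => // x _.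
by have : [set: G] x by []; rewrite -gS; apply.
Qed.

Lemma generatingP S :
  (forall V, group_closed (mem V) -> S `<=` V -> V = [set: G]) ->
  generating S.
Proof.
move=> gS; apply/seteqP; split => // x _ V [gV SV].
by rewrite (gS V).
Qed.

Lemma set_mulg_compact A B : compact A -> compact B -> compact (set_mulg A B).
Proof.
move=> cA cB.
have -> : set_mulg A B = (fun p : G * G => (p.1 * p.2)%g) @` (A `*` B).
  apply/seteqP; split => x.
    by move=> [a Aa [b Bb <-]]; exists (a, b).
  by move=> [[a b] [/= Aa Bb] <-]; exists a => //; exists b.
apply: continuous_compact; last exact: compact_setX.
exact/continuous_subspaceT/mulg_continuous.
Qed.

Lemma set_invg_compact A : compact A -> compact A^-1s.
Proof.
move=> cA; apply: continuous_compact => //.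
exact/continuous_subspaceT/invg_continuous.
Qed.

Lemma set_invgE A x : A^-1s x = A (x^-1)%g.
Proof.
apply/propext; split => [[y Ay <-]|Ax]; first by rewrite invgK.
by exists x^-1%g => //; rewrite invgK.
Qed.

Lemma set_mul1gE g A x : set_mulg [set g] A x = A (g^-1 * x)%g.
Proof.
apply/propext; split => [[_ -> [a Aa <-]]|Ax]; first by rewrite mulKg.
by exists g => //; exists (g^-1 * x)%g => //; rewrite mulVKg.
Qed.

Lemma set_mulg1E g A x : set_mulg A [set g] x = A (x * g^-1)%g.
Proof.
apply/propext; split => [[a Aa [_ -> <-]]|Ax]; first by rewrite mulgK.
by exists (x * g^-1)%g => //; exists g => //; rewrite mulgVK.
Qed.

Lemma set_mul1g_open g A : open A -> open (set_mulg [set g] A).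
Proof.
move=> oA; rewrite (_ : set_mulg _ _ = (fun x => g^-1 * x)%g @^-1` A).
  by apply: open_comp => // x _; exact: mulgl_continuous.
by apply/funext => x; rewrite set_mul1gE.
Qed.

Lemma set_mulg1_open g A : open A -> open (set_mulg A [set g]).
Proof.
move=> oA; rewrite (_ : set_mulg _ _ = (fun x => x * g^-1)%g @^-1` A).
  by apply: open_comp => // x _; exact: mulgr_continuous.
by apply/funext => x; rewrite set_mulg1E.
Qed.

Lemma set_mulg1M A x y :
  set_mulg A [set (x * y)%g] = set_mulg (set_mulg A [set x]) [set y].
Proof. by apply/funext => z; rewrite !set_mulg1E invgM mulgA. Qed.

Lemma open_measurable_borel A : open A -> measurable (A : set (borel G)).
Proof. by move=> oA; exact: sub_sigma_algebra. Qed.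

Lemma compact_measurable_borel A : hausdorff_space G -> compact A ->
  measurable (A : set (borel G)).
Proof.
move=> hG /(compact_closed hG) cA; rewrite -[A]setCK.
by apply: measurableC; apply: open_measurable_borel; exact: closed_openC.
Qed.

(** Finitely many cosets of [V] cover [K]; deleting repetitions leaves
representatives of pairwise distinct cosets. *)
Lemma coset_transversal V K : group_closed (mem V) -> open V -> compact K ->
  exists s : seq G, [/\ {in s, forall x, K x},
    pairwise (fun x y => ~~ `[< V (x^-1 * y)%g >]) s &
    forall y, K y -> exists2 x, x \in s & V (x^-1 * y)%g].
Proof.
move=> gV oV cK.
have [D DK KD] : finite_subset_cover K (fun x => set_mulg [set x] V) K.
  move: cK; rewrite compact_cover; apply.
    by move=> x _; exact: set_mul1g_open.
  move=> x Kx; exists x => //; rewrite set_mul1gE mulVg.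
  exact: set_group_closed1.
have /finite_seqP[r Dr] := finite_fset D.
rewrite Dr in KD.
have rK x : [set` r] x -> K x by rewrite -Dr => /DK/set_mem.
have [s [sD sep cov]] : exists s : seq G, [/\ {subset s <= r},
    pairwise (fun x y => ~~ `[< V (x^-1 * y)%g >]) s &
    forall y, y \in r -> exists2 x, x \in s & V (x^-1 * y)%g].
  elim: {Dr KD rK} r => [|a r [s [sr sep cov]]]; first by exists [::].
  have [[x xs Vxa]|nex] := pselect (exists2 x, x \in s & V (x^-1 * a)%g).
    exists s; split=> // [y /sr yr|y]; first by rewrite inE yr orbT.
    by rewrite inE => /orP[/eqP ->|/cov//]; exists x.
  exists (a :: s); split.
  - by move=> y; rewrite !inE => /orP[->//|/sr ->]; rewrite orbT.
  - rewrite /= sep andbT; apply/allP => y ys; apply/asboolPn => Vay.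
    apply: nex; exists y => //.
    by rewrite -[(_ * _)%g]invgK invgM invgK; exact: set_group_closedV.
  - move=> y; rewrite inE => /orP[/eqP ->|/cov[x xs Vx]].
      by exists a; rewrite ?inE ?eqxx// mulVg; exact: set_group_closed1.
    by exists x => //; rewrite inE xs orbT.
exists s; split => //.
  by move=> x /sD/rK.
move=> y /KD[x /= xD]; rewrite set_mul1gE => Vxy.
have [z zs Vzx] := cov x xD; exists z => //.
have -> : (z^-1 * y = (z^-1 * x) * (x^-1 * y))%g by rewrite -mulgA mulVKg.
exact: set_group_closedM.
Qed.

Lemma coset_decomposition V (s : seq G) A : group_closed (mem V) ->
  (forall x v, A x -> V v -> A (x * v)%g) ->
  (forall y, A y -> exists2 x, x \in s & V (x^-1 * y)%g) ->
  A = \big[setU/set0]_(x <- [seq x <- s | `[< A x >]]) set_mulg [set x] V.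
Proof.
move=> gV AV cov; rewrite -bigcup_seq; apply/seteqP; split => y.
  move=> Ay; have [x xs Vxy] := cov y Ay.
  exists x => /=; last by rewrite set_mul1gE.
  rewrite mem_filter xs andbT; apply/asboolP.
  rewrite (_ : x = (y * (x^-1 * y)^-1)%g) ; last by rewrite invgM invgK mulVKg.
  by apply: AV => //; exact: set_group_closedV.
move=> [x /=]; rewrite mem_filter => /andP[/asboolP Ax _]; rewrite set_mul1gE.
by move=> Vxy; rewrite -(mulVKg x y); exact: AV.
Qed.

Lemma coset_disjoint V x y : group_closed (mem V) -> ~~ `[< V (x^-1 * y)%g >] ->
  set_mulg [set x] V `&` set_mulg [set y] V = set0.
Proof.
move=> gV /asboolPn nV; apply/seteqP; split => // z [].
rewrite !set_mul1gE => Vx Vy; apply: nV.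
have -> : (x^-1 * y = (x^-1 * z) * (y^-1 * z)^-1)%g.
  by rewrite invgM invgK -mulgA mulVKg.
by apply: set_group_closedM => //; exact: set_group_closedV.
Qed.

Lemma right_invariant_compact V (s : seq G) A :
  compact V -> group_closed (mem V) ->
  (forall x v, A x -> V v -> A (x * v)%g) ->
  (forall y, A y -> exists2 x, x \in s & V (x^-1 * y)%g) ->
  compact A.
Proof.
move=> cV gV AV cov; rewrite (coset_decomposition gV AV cov).
apply: bigsetU_compact => x _; apply: set_mulg_compact => //.
exact: compact_set1.
Qed.

End TopologicalGroup.

(** * Haar measure of unions of cosets and the modular function *)

Lemma measure_pairwise_bigsetU d (R : realType) (T : measurableType d)
    (mu : {measure set T -> \bar R}) (I : choiceType) (F : I -> set T)
    (s : seq I) :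
  (forall i, measurable (F i)) ->
  pairwise (fun i j => `[< F i `&` F j = set0 >]) s ->
  mu (\big[setU/set0]_(i <- s) F i) = (\sum_(i <- s) mu (F i))%E.
Proof.
move=> mF; elim: s => [|i s IH] /=; first by rewrite !big_nil measure0.
move=> /andP[/allP dis sep]; rewrite !big_cons measureU//.
- by congr (_ + _)%E; exact: IH.
- exact: bigsetU_measurable.
- rewrite -bigcup_seq; apply/seteqP; split => // x [Fx [j /= js Fjx]].
  have /asboolP FF := dis j js.
  by have : (F i `&` F j) x by []; rewrite FF.
Qed.

Section Haar.
Context {R : realType} {G : topologicalGroupType}.
Context {mu : {measure set (borel G) -> \bar R}} {Delta : G -> Rpos R}.
Hypothesis hG : hausdorff_space G.
Hypothesis haar_mu : left_haar mu.
Hypothesis modular_Delta : modular_function mu Delta.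
Implicit Types (A B K O S U V : set G) (g h s x y : G).

Local Notation d g := (\val (Delta g)).

Lemma modular_gt0 g : 0 < d g.
Proof. by have := valP (Delta g); rewrite inE. Qed.

Lemma haar_compact_fin_num K : compact K -> mu K \is a fin_num.
Proof. by move=> cK; rewrite ge0_fin_numE// haar_compact_fin. Qed.

Lemma haar_compact_pos : exists2 K : set G, compact K & (0 < mu K)%E.
Proof.
apply: contrapT => nK; apply: (haar_neq0 haar_mu); apply/eqP.
rewrite eq_le measure_ge0 andbT (haar_inner_regular haar_mu openT).
apply: ge_ereal_sup => _ [K [cK _] <-]; rewrite leNgt; apply/negP => K0.
by apply: nK; exists K.
Qed.

Lemma modularM x y : d (x * y)%g = d x * d y.
Proof.
have [K cK K0] := haar_compact_pos.
have mK := compact_measurable_borel hG cK.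
have fK := haar_compact_fin_num cK.
have mKx : measurable (set_mulg K [set x] : set (borel G)).
  apply: compact_measurable_borel => //.
  by apply: set_mulg_compact => //; exact: compact_set1.
have := modular_Delta (x * y)%g mK.
rewrite set_mulg1M (modular_Delta y mKx) (modular_Delta x mK) muleA.
rewrite -(fineK fK) -!EFinM.
have K0' : fine (mu K) != 0 by rewrite fine_eq0// gt_eqF.
by move=> e; rewrite -(mulIf K0' (EFin_inj e)) mulrC.
Qed.

Lemma modular1 : d 1%g = 1.
Proof.
have := modularM 1%g 1%g; rewrite mulg1 => /eqP.
rewrite -[X in X == _]mulr1 => /eqP/mulfI -> //.
by rewrite gt_eqF// modular_gt0.
Qed.

Lemma modularV x : d (x^-1)%g = (d x)^-1.
Proof.
have dx0 : d x != 0 by rewrite lt0r_neq0// modular_gt0.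
by apply: (mulfI dx0); rewrite -modularM mulgV modular1 mulfV.
Qed.

Lemma modularX x n : d (x ^+ n)%g = d x ^+ n.
Proof.
elim: n => [|n IH]; first by rewrite expg0 modular1 expr0.
by rewrite expgS modularM IH exprS.
Qed.

Section Subgroup.
Variable V : set G.
Hypotheses (cV : compact V) (oV : open V) (gV : group_closed (mem V)).

Let mV : measurable (V : set (borel G)).
Proof. exact: compact_measurable_borel. Qed.

Lemma measure_coset x : mu (set_mulg [set x] V) = mu V.
Proof. exact: haar_left_invariant. Qed.

Lemma measure_right_invariant (s : seq G) A :
  pairwise (fun x y => ~~ `[< V (x^-1 * y)%g >]) s ->
  (forall x v, A x -> V v -> A (x * v)%g) ->
  (forall y, A y -> exists2 x, x \in s & V (x^-1 * y)%g) ->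
  mu A = (fine (mu V) * \sum_(x <- s | `[< A x >]) 1)%:E.
Proof.
move=> sep AV cov; rewrite {1}(coset_decomposition gV AV cov).
rewrite measure_pairwise_bigsetU; last 2 first.
- by move=> x; apply: open_measurable_borel; exact: set_mul1g_open.
- apply: (sub_pairwise _ (pairwise_filter _ sep)).
  by move=> x y /(coset_disjoint gV) ?; apply/asboolP.
rewrite big_filter mulr_sumr -sumEFin; apply: eq_bigr => x _.
by rewrite measure_coset mulr1 fineK// haar_compact_fin_num.
Qed.

(** [mu] of an inverse is a right Haar measure; the inverse of [xV] is the right
translate of [V] by the inverse of [x], hence the weight [(d x)^-1]. *)
Lemma measure_inv_right_invariant (s : seq G) A :
  pairwise (fun x y => ~~ `[< V (x^-1 * y)%g >]) s ->
  (forall x v, A x -> V v -> A (x * v)%g) ->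
  (forall y, A y -> exists2 x, x \in s & V (x^-1 * y)%g) ->
  mu A^-1s = (fine (mu V) * \sum_(x <- s | `[< A x >]) (d x)^-1)%:E.
Proof.
move=> sep AV cov.
have -> : A^-1s = \big[setU/set0]_(x <- [seq x <- s | `[< A x >]])
    set_mulg V [set (x^-1)%g].
  apply/funext => y.
  rewrite set_invgE {1}(coset_decomposition gV AV cov) -!bigcup_seq.
  apply/propext; split => -[x xs] /=.
    rewrite set_mul1gE => Vx; exists x => //=.
    by rewrite set_mulg1E -[y]invgK -invgM; exact: set_group_closedV.
  rewrite set_mulg1E => Vx; exists x => //=.
  by rewrite set_mul1gE -[X in V X]invgK invgM invgK; exact: set_group_closedV.
rewrite measure_pairwise_bigsetU; last 2 first.
- by move=> x; apply: open_measurable_borel; exact: set_mulg1_open.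
- apply: (sub_pairwise _ (pairwise_filter _ sep)).
  move=> x y /(coset_disjoint gV) xy0; apply/asboolP/seteqP; split => // z [].
  rewrite !set_mulg1E !invgK => Vx Vy.
  suff : (set_mulg [set x] V `&` set_mulg [set y] V) (z^-1)%g.
    by rewrite xy0.
  by split; rewrite set_mul1gE -invgM; exact: set_group_closedV.
rewrite big_filter mulr_sumr -sumEFin; apply: eq_bigr => x _.
by rewrite modular_Delta// modularV mulrC EFinM fineK// haar_compact_fin_num.
Qed.

(** Some compact set has positive measure, and finitely many cosets of [V], all of
measure [mu V], cover it. *)
Lemma haar_open_subgroup_gt0 : (0 < mu V)%E.
Proof.
have [K cK K0] := haar_compact_pos.
rewrite lt0e measure_ge0 andbT; apply/eqP => V0.
pose A := set_mulg K V.
have cA : compact A by exact: set_mulg_compact.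
have AV x v : A x -> V v -> A (x * v)%g.
  move=> [k Kk [w Vw <-]] Vv; exists k => //.
  exists (w * v)%g; last exact: mulgA.
  exact: set_group_closedM.
have [s [_ sep cov]] := coset_transversal gV oV cA.
have := measure_right_invariant sep AV cov; rewrite V0 mul0r.
have : (mu K <= mu A)%E.
  apply: le_measure; rewrite ?inE; try exact: compact_measurable_borel.
  move=> k Kk; exists k => //; exists 1%g; last exact: mulg1.
  exact: set_group_closed1.
by move=> KA A0; move: (lt_le_trans K0 KA); rewrite A0 ltxx.
Qed.

(** Right translation by an element of [V] preserves [V], whose measure is positive
and finite. *)
Lemma modular_subgroup v : V v -> d v = 1.
Proof.
move=> Vv; have := modular_Delta v mV.
have -> : set_mulg V [set v] = V.
  apply/funext => x; rewrite set_mulg1E; apply/propext; split => Vx.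
    by rewrite -(mulgVK v x); exact: set_group_closedM.
  by apply: set_group_closedM => //; exact: set_group_closedV.
have fV := haar_compact_fin_num cV.
rewrite -(fineK fV) -EFinM.
have V0 : fine (mu V) != 0.
  by rewrite fine_eq0// gt_eqF// haar_open_subgroup_gt0.
rewrite -[X in X%:E = _]mul1r.
by move=> e; rewrite -(mulIf V0 (EFin_inj e)).
Qed.
End Subgroup.

End Haar.

(** * A finite layer-cake inequality *)

(** For an increasing sequence [a <= v1 <= ... <= vn], the sum of the increments
[v_k - v_(k-1)] over the levels [v_k <= x]; it telescopes to [x - a] when [x] is
one of the levels. *)
Fixpoint layers (R : realFieldType) (a : R) (vs : seq R) (x : R) : R :=
  if vs is v :: vs' then (v - a) * (v <= x)%R%:R + layers v vs' x else 0.

Lemma layers_low (R : realFieldType) (a x : R) (vs : seq R) :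
  path <=%R a vs -> x <= a -> layers a vs x = 0.
Proof.
elim: vs a => //= v vs IH a /andP[av pv] xa.
rewrite (IH v pv (le_trans xa av)) addr0.
have [vx|_] := boolP (v <= x); last by rewrite mulr0.
have -> : v = a by apply/eqP; rewrite eq_le av andbT (le_trans vx xa).
by rewrite subrr mul0r.
Qed.

Lemma layersE (R : realFieldType) (a x : R) (vs : seq R) :
  path <=%R a vs -> x \in a :: vs -> layers a vs x = x - a.
Proof.
elim: vs a => [|v vs IH] a /=; first by rewrite inE => _ /eqP ->; rewrite subrr.
move=> /andP[av pv]; rewrite inE => /orP[/eqP ->|xv].
  by have /= := @layers_low R a a (v :: vs); rewrite av pv subrr => ->.
have vx : v <= x.
  move: xv; rewrite inE => /orP[/eqP -> //|xvs].
  by move/(order_path_min le_trans)/allP : pv; exact.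
by rewrite vx mulr1 (IH v pv xv); ring.
Qed.

(** [\sum_i f i] is the integral over [t > 0] of the number of [i] with [t <= f i].
Only finitely many levels matter, so the integral is written as a sum of
increments over the sorted values of [f] and [g]. *)
Lemma layer_cake (R : realFieldType) (I : eqType) (s : seq I) (f g : I -> R)
    (c : R) :
  (forall i, 0 <= f i) -> (forall i, 0 <= g i) ->
  (forall t, 0 < t ->
    c * \sum_(i <- s | t <= f i) 1 <= \sum_(i <- s | t <= g i) 1) ->
  c * \sum_(i <- s) f i <= \sum_(i <- s) g i.
Proof.
move=> f0 g0 fg.
pose vs := sort <=%R (map f s ++ map g s).
have pvs : path <=%R 0 vs.
  rewrite path_min_sorted ?sort_le_sorted// all_sort all_cat !all_map.
  by apply/andP; split; apply/allP => i _ /=.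
have fE : \sum_(i <- s) f i = \sum_(i <- s) layers 0 vs (f i).
  apply: eq_big_seq => i si; rewrite layersE ?subr0//.
  by rewrite inE mem_sort mem_cat map_f ?orbT.
have gE : \sum_(i <- s) g i = \sum_(i <- s) layers 0 vs (g i).
  apply: eq_big_seq => i si; rewrite layersE ?subr0//.
  by rewrite inE mem_sort mem_cat (map_f g) ?orbT.
rewrite fE gE {fE gE}.
suff H a : 0 <= a -> path <=%R a vs ->
    c * \sum_(i <- s) layers a vs (f i) <= \sum_(i <- s) layers a vs (g i).
  exact: H.
elim: {pvs} vs a => /= [a _ _|v vs IH a a0 /andP[av pv]].
  by rewrite !big1_eq mulr0.
rewrite !big_split/= mulrDr lerD//; last first.
  by apply: IH => //; exact: le_trans av.
rewrite -!mulr_sumr mulrCA.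
have countE (h : I -> R) :
    \sum_(i <- s) (v <= h i)%R%:R = \sum_(i <- s | v <= h i) 1 :> R.
  by rewrite [RHS]big_mkcond; apply: eq_bigr => i _; case: ifP.
rewrite !countE; have [v0|v0] := ltP 0 v.
  by apply: ler_wpM2l; [rewrite subr_ge0|exact: fg].
have -> : v - a = 0 by apply/eqP; rewrite subr_eq0 eq_le av (le_trans v0 a0).
by rewrite !mul0r.
Qed.

(** * Quotients by finite positive extended reals *)

Lemma lee_pdivlMr_fin (R : realFieldType) (x y z : \bar R) :
  y \is a fin_num -> (0 < y)%E ->
  (x <= z / y)%E = (x * y <= z)%E.
Proof.
move=> fy y0; rewrite -(fineK fy) in y0 *; rewrite lte_fin in y0.
by rewrite inver gt_eqF// lee_pdivlMr.
Qed.

Lemma lee_pdivrMr_fin (R : realFieldType) (x y z : \bar R) :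
  y \is a fin_num -> (0 < y)%E ->
  (z / y <= x)%E = (z <= x * y)%E.
Proof.
move=> fy y0; rewrite -(fineK fy) in y0 *; rewrite lte_fin in y0.
by rewrite inver gt_eqF// lee_pdivrMr.
Qed.

(** * Generating sets on which the modular function is small *)

(** Powers grow at least linearly, by Bernoulli's inequality. *)
Lemma exprn_unbounded (R : archiRealFieldType) (l x : R) : 1 < l ->
  exists n : nat, x < l ^+ n.
Proof.
move=> l1.
have bern n : 1 + n%:R * (l - 1) <= l ^+ n.
  elim: n => [|n IH]; first by rewrite mul0r addr0 expr0.
  rewrite exprS; apply: (@le_trans _ _ (l * (1 + n%:R * (l - 1)))); last first.
    by rewrite ler_wpM2l// ltW// (lt_trans ltr01).
  rewrite -natr1 -subr_ge0.
  have -> : l * (1 + n%:R * (l - 1)) - (1 + (n%:R + 1) * (l - 1)) =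
    n%:R * (l - 1) ^+ 2.
    by ring.
  by rewrite mulr_ge0// sqr_ge0.
have xl0 : 0 <= `|x| / (l - 1) by rewrite divr_ge0// subr_ge0 ltW.
have := archi_boundP xl0; set n := Num.bound _ => xn.
exists n; apply: lt_le_trans (bern n).
move: xn; rewrite ltr_pdivrMr ?subr_gt0// => xn.
have := ler_norm x; lra.
Qed.

Section Folner.
Context {R : realType} {G : topologicalGroupType}.
Context {mu : {measure set (borel G) -> \bar R}} {Delta : G -> Rpos R}.
Hypothesis hG : hausdorff_space G.
Hypothesis haar_mu : left_haar mu.
Hypothesis modular_Delta : modular_function mu Delta.
Implicit Types (A B K O S U V : set G) (g h s x y : G).

Local Notation d g := (\val (Delta g)).
Local Notation dM := (modularM hG haar_mu modular_Delta).
Local Notation dV := (modularV hG haar_mu modular_Delta).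
Local Notation d1 := (modular1 hG haar_mu modular_Delta).
Local Notation dX := (modularX hG haar_mu modular_Delta).

(** [g] is the power of [h] whose modulus is the largest one not exceeding [x]; the
exponent is found as a minimum, separately for [x >= 1] and [x < 1]. *)
Lemma modular_window h (x : R) : 1 < d h -> 0 < x ->
  exists g, [/\ forall V, group_closed (mem V) -> V h -> V g,
    d g <= x & x < d g * d h].
Proof.
move=> h1 x0.
have gen V n : group_closed (mem V) -> V h -> V (h ^+ n)%g.
  move=> gV Vh; elim: n => [|n IH].
    by rewrite expg0; exact: set_group_closed1.
  by rewrite expgS; exact: set_group_closedM.
have dh0 : 0 < d h by exact: modular_gt0.
have [x1|x1] := leP 1 x.
  have ex : exists n, x < d h ^+ n by exact: exprn_unbounded.
  case: (ex_minnP ex) => -[|n] xn minn.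
    by move: xn; rewrite expr0 ltNge x1.
  exists (h ^+ n)%g; split; first by move=> V; exact: gen.
    by rewrite dX leNgt; apply/negP => /minn; rewrite ltnn.
  by rewrite dX -exprSr.
have ex : exists n, x^-1 <= d h ^+ n.
  by have [n /ltW xn] := exprn_unbounded x^-1 h1; exists n.
case: (ex_minnP ex) => -[|n] xn minn.
  by move: xn; rewrite expr0 leNgt invf_gt1// x1.
exists (h ^+ n.+1)^-1%g; split.
- by move=> V gV Vh; apply: set_group_closedV => //; exact: gen.
- by rewrite dV dX invf_ple// posrE exprn_gt0.
- rewrite dV dX exprS invfM mulrAC mulVf ?lt0r_neq0// mul1r.
  rewrite invf_pgt ?posrE ?exprn_gt0// ltNge; apply/negP => /minn.
  by rewrite ltnn.
Qed.

(** A compact generating set is covered by finitely many cosets [kV]. Each [k] is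
the product of a power of [h] and an element with modulus in [[1, q]]; the latter
elements, [h], [V] and all inverses generate [G]. *)
Lemma small_generating_set V (q : R) :
  group_closed (mem V) -> open V -> compact V ->
  compactly_generated G -> (exists h, 1 < d h <= q) ->
  exists S, [/\ compact S, symmetric_set S & generating S] /\
    [/\ V `<=` S, set_mulg V S `<=` S, set_mulg S V `<=` S &
       forall s, S s -> d s <= q].
Proof.
move=> gV oV cV [K cK gK] [h /andP[h1 hq]].
have dV1 v : V v -> d v = 1.
  by apply: (modular_subgroup hG haar_mu modular_Delta).
have /choice[f fP] k : exists g, [/\
    forall V, group_closed (mem V) -> V h -> V g,
    d g <= d k & d k < d g * d h].
  by apply: modular_window => //; exact: modular_gt0.
have [ks [_ _ cov]] := coset_transversal gV oV cK.
pose L0 := [:: 1%g, h & [seq ((f k)^-1 * k)%g | k <- ks]].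
have L0P x : x \in L0 -> 1 <= d x <= q.
  rewrite !inE => /or3P[/eqP ->|/eqP ->|/mapP[k _ ->]].
  - by rewrite d1 lexx (le_trans _ hq)// ltW.
  - by rewrite hq ltW.
  - have [_ fk1 fk2] := fP k; rewrite dM dV mulrC.
    rewrite ler_pdivlMr ?modular_gt0// mul1r fk1 ler_pdivrMr ?modular_gt0//=.
    by rewrite (le_trans (ltW fk2))// mulrC ler_pM2r// modular_gt0.
pose L := L0 ++ [seq x^-1%g | x <- L0].
have LV x : x \in L -> x^-1%g \in L.
  rewrite !mem_cat => /orP[xL|/mapP[y yL ->]]; first by rewrite map_f ?orbT.
  by rewrite invgK yL.
have q0 : 1 <= q by rewrite (le_trans _ hq)// ltW.
have Lq x : x \in L -> d x <= q.
  rewrite mem_cat => /orP[/L0P/andP[]//|/mapP[y /L0P/andP[y1 _] ->]].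
  by rewrite dV (le_trans _ q0)// invf_le1// modular_gt0.
pose S := set_mulg V (set_mulg [set` L] V).
have SE v x w : V v -> x \in L -> V w -> S (v * (x * w))%g.
  move=> Vv xL Vw; exists v => //; exists (x * w)%g => //.
  by exists x => //; exists w.
have VS : V `<=` S.
  move=> v Vv; rewrite -[v]mulg1 -[1%g]mulg1; apply: SE => //.
    by rewrite inE eqxx.
  exact: set_group_closed1.
exists S; split; split => //.
- apply: set_mulg_compact => //; apply: set_mulg_compact => //.
  by apply: finite_compact; exact: finite_seq.
- have SV x : S x -> S (x^-1)%g.
    move=> [v Vv [_ [l lL [w Vw <-]] <-]]; rewrite !invgM -mulgA.
    by apply: SE; [exact: set_group_closedV|exact: LV|exact: set_group_closedV].
  apply/seteqP; split => x; first by move=> [y /SV Sy <-].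
  by move=> /SV Sx; exists x^-1%g => //; rewrite invgK.
- apply: generatingP => H gH SH.
  apply: (generating_sub gK gH) => k Kk.
  have LH x : x \in L -> H x.
    move=> xL; apply: SH; rewrite -[x]mul1g -[x]mulg1.
    by apply: SE => //; exact: set_group_closed1.
  have [x xs Vx] := cov k Kk.
  rewrite -(mulVKg x k).
  apply: set_group_closedM => //; last exact/SH/VS.
  rewrite -(mulVKg (f x) x).
  apply: set_group_closedM => //.
    by have [+ _ _] := fP x; apply => //; apply: LH; rewrite !inE eqxx orbT.
  apply: LH; rewrite mem_cat !inE (map_f (fun k => (f k)^-1 * k)%g xs).
  by rewrite !orbT.
- move=> _ [u Vu [_ [v Vv [y yS <-]] <-]]; rewrite mulgA.
  by exists (u * v)%g; [exact: set_group_closedM|exists y].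
- move=> _ [_ [v Vv [_ [l lL [w Vw <-]] <-]] [u Vu <-]]; rewrite -!mulgA.
  by apply: SE => //; exact: set_group_closedM.
- move=> _ [v Vv [_ [l lL [w Vw <-]] <-]].
  by rewrite !dM (dV1 v Vv) (dV1 w Vw) mul1r mulr1 Lq.
Qed.

(** * Growth of level sets *)

(** If right multiplication by [S] expands every compact set by the factor [c], then
so does left multiplication of [V U0] by [S], up to the factor [q]. The cosets in
[E = U0^-1 S] and [F = U0^-1 V], weighted by [(d x)^-1], compute the two sides;
the hypothesis, applied to the level sets [U] of the weight on [F], compares the
numbers of cosets above each level [t], and [layer_cake] sums over [t]. *)
Lemma growth_transfer V S U0 (q c : R) :
  compact V -> open V -> group_closed (mem V) ->
  compact S -> V `<=` S -> symmetric_set S ->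
  set_mulg V S `<=` S -> set_mulg S V `<=` S -> (forall s, S s -> d s <= q) ->
  0 < q -> compact U0 ->
  (forall U, compact U -> (c%:E * mu U <= mu (set_mulg U S))%E) ->
  (c%:E * mu (set_mulg V U0) <= q%:E * mu (set_mulg S U0))%E.
Proof.
move=> cV oV gV cS VS symS VSS SVS Sq q0 cU0 cH.
have dV1 v : V v -> d v = 1.
  by apply: (modular_subgroup hG haar_mu modular_Delta).
have mV0 : 0 < fine (mu V).
  rewrite fine_gt0// (haar_open_subgroup_gt0 hG haar_mu)//=.
  exact: haar_compact_fin.
pose E := set_mulg U0^-1s S; pose F := set_mulg U0^-1s V.
have cE : compact E by apply: set_mulg_compact => //; exact: set_invg_compact.
have EV x v : E x -> V v -> E (x * v)%g.
  move=> [u Uu [s Ss <-]] Vv; exists u => //.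
  exists (s * v)%g; last exact: mulgA.
  by apply: SVS; exists s => //; exists v.
have FV x v : F x -> V v -> F (x * v)%g.
  move=> [u Uu [s Ss <-]] Vv; exists u => //.
  exists (s * v)%g; last exact: mulgA.
  exact: set_group_closedM.
have FE : F `<=` E.
  by move=> _ [u Uu [v Vv <-]]; exists u => //; exists v => //; exact: VS.
have FSE x s : F x -> S s -> E (x * s)%g.
  move=> [u Uu [v Vv <-]] Ss; exists u => //.
  exists (v * s)%g; last exact: mulgA.
  by apply: VSS; exists v => //; exists s.
have invV A : A^-1s = A -> (set_mulg U0^-1s A)^-1s = set_mulg A U0.
  move=> AA; have AV x : A x -> A x^-1%g by move=> Ax; rewrite -AA; exists x.
  apply/seteqP; split => [_ [_ [_ [u Uu <-] [a Aa <-]] <-]|_ [a Aa [u Uu <-]]].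
    by rewrite invgM invgK; exists a^-1%g; [exact: AV|exists u].
  exists (u^-1 * a^-1)%g; last by rewrite invgM !invgK.
  by exists u^-1%g; [exists u|exists a^-1%g => //; exact: AV].
have symV : V^-1s = V.
  apply/funext => x; rewrite set_invgE; apply/propext; split => Vx.
    by rewrite -[x]invgK; exact: set_group_closedV.
  exact: set_group_closedV.
have [s [_ sep cov]] := coset_transversal gV oV cE.
have covF y : F y -> exists2 x, x \in s & V (x^-1 * y)%g by move=> /FE/cov.
rewrite -(invV _ symS) -(invV _ symV) -/E -/F.
rewrite (measure_inv_right_invariant hG haar_mu modular_Delta cV oV gV sep
  FV covF).
rewrite (measure_inv_right_invariant hG haar_mu modular_Delta cV oV gV sep
  EV cov).
rewrite -!EFinM lee_fin mulrCA [leRHS]mulrCA ler_pM2l//.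
pose f x := if `[< F x >] then (d x)^-1 else 0.
pose g x := if `[< E x >] then q * (d x)^-1 else 0.
have dinv x : 0 < (d x)^-1 by rewrite invr_gt0; exact: modular_gt0.
rewrite [leRHS]mulr_sumr.
have -> : \sum_(x <- s | `[< F x >]) (d x)^-1 = \sum_(x <- s) f x.
  exact: big_mkcond.
have -> : \sum_(x <- s | `[< E x >]) (q * (d x)^-1) = \sum_(x <- s) g x.
  exact: big_mkcond.
apply: layer_cake.
- by move=> x; rewrite /f; case: ifP => // _; exact: ltW.
- by move=> x; rewrite /g; case: ifP => // _; rewrite mulr_ge0// ltW.
move=> t t0.
pose U : set G := [set x | F x /\ t <= (d x)^-1].
pose B : set G := [set x | E x /\ t <= q * (d x)^-1].
have -> : \sum_(x <- s | t <= f x) 1 = \sum_(x <- s | `[< U x >]) 1 :> R.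
  apply: eq_bigl => x; rewrite /f /U /=; case: asboolP => Fx.
    by apply/idP/asboolP => [|[]].
  by rewrite leNgt t0; apply/esym/asboolPn => -[].
have -> : \sum_(x <- s | t <= g x) 1 = \sum_(x <- s | `[< B x >]) 1 :> R.
  apply: eq_bigl => x; rewrite /g /B /=; case: asboolP => Ex.
    by apply/idP/asboolP => [|[]].
  by rewrite leNgt t0; apply/esym/asboolPn => -[].
have UV x v : U x -> V v -> U (x * v)%g.
  by move=> [Fx tx] Vv; split; [exact: FV|rewrite dM (dV1 v Vv) mulr1].
have BV x v : B x -> V v -> B (x * v)%g.
  by move=> [Fx tx] Vv; split; [exact: EV|rewrite dM (dV1 v Vv) mulr1].
have covU y : U y -> exists2 x, x \in s & V (x^-1 * y)%g by move=> [/covF].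
have covB y : B y -> exists2 x, x \in s & V (x^-1 * y)%g by move=> [/cov].
have cU : compact U by exact: (right_invariant_compact cV gV UV covU).
have cB : compact B by exact: (right_invariant_compact cV gV BV covB).
have USB : set_mulg U S `<=` B.
  move=> _ [u [Fu tu] [r Sr <-]]; split; first exact: FSE.
  rewrite dM invfM mulrCA; apply: (le_trans tu).
  by rewrite ler_pMr// ler_pdivlMr ?mul1r; [exact: Sq|exact: modular_gt0].
have := cH U cU; have : (mu (set_mulg U S) <= mu B)%E.
  apply: le_measure; rewrite ?inE//; apply: compact_measurable_borel => //.
  exact: set_mulg_compact.
move=> /[swap] /le_trans /[apply].
rewrite (measure_right_invariant hG haar_mu cV oV gV sep UV covU).
rewrite (measure_right_invariant hG haar_mu cV oV gV sep BV covB).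
by rewrite -EFinM lee_fin mulrCA ler_pM2l.
Qed.

(** * Boundaries and the Folner constant *)

Lemma dense_modular_small : dense (range Delta) ->
  forall q : R, 1 < q -> exists h, 1 < d h < q.
Proof.
move=> dD q q1.
have oO : open ((\val : Rpos R -> R) @^-1` `]1, q[).
  apply: open_comp; last exact: interval_open.
  by move=> x _; exact: initial_continuous.
have [|y [/= hq [h _ hE]]] := dD _ _ oO.
  have p : (1 + q) / 2 \in [set x : R | 0 < x] by rewrite inE /=; lra.
  exists (exist (fun r : R => r \in [set x : R | 0 < x]) _ p) => /=.
  by rewrite in_itv/=; lra.
by exists h; rewrite hE; move: hq; rewrite in_itv.
Qed.

(** Near a given [x > 0] the powers of [h] include some [g] with
[d g <= x < d g * d h], and then [x - d g < d g * (d h - 1) <= x * (d h - 1)]. *)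
Lemma small_modular_dense :
  (forall e : R, 0 < e -> exists h, 1 < d h < 1 + e) ->
  dense (range Delta).
Proof.
move=> small O [x Ox] [ O' oO' O'E].
have x0 : 0 < \val x by have := valP x; rewrite inE.
have O'x : O' (\val x) by move: Ox; rewrite -O'E.
have /nbhs_ballP[e /= e0 eO'] : nbhs (\val x) O' by exact: open_nbhs_nbhs.
have [h /andP[h1 he]] : exists h, 1 < d h < 1 + e / \val x.
  by apply: small; exact: divr_gt0.
have [g [_ gx xg]] := modular_window h1 x0.
exists (Delta g); split; last by exists g.
rewrite -O'E; apply: eO'; rewrite /ball /=.
rewrite ger0_norm ?subr_ge0// ltrBlDl; apply: (lt_trans xg).
have g0 : 0 < d g by exact: modular_gt0.
apply: (@lt_le_trans _ _ (d g * (1 + e / \val x))); first by rewrite ltr_pM2l.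
rewrite mulrDr mulr1 lerD2l mulrCA -[leRHS]mulr1 ler_pM2l//.
by rewrite ler_pdivrMr// mul1r.
Qed.

(** Otherwise the kernel of the modular function is a subgroup containing [S]. *)
Lemma generating_modular S : generating S -> ~ unimodular Delta ->
  exists2 s, S s & d s != 1.
Proof.
move=> gS nu; apply: contrapT => nS; apply: nu => g.
have H : group_closed (mem [set x | d x = 1]).
  apply: set_group_closedP => [|x y dx dy]; first exact: d1.
  by rewrite /mkset dM dV (dx : d x = 1) (dy : d y = 1) invr1 mulr1.
suff : [set x | d x = 1] g by [].
rewrite (generating_sub gS H)// => s Ss /=; apply: contrapT => /eqP ds.
by apply: nS; exists s.
Qed.

(** [Us] has measure [d s * mu U] and is covered by [US \ U] and [U]. *)
Lemma modular_boundary S U s : compact S -> S s -> compact U -> (0 < mu U)%E ->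
  ((d s - 1)%:E <= mu (set_mulg U S `\` U) / mu U)%E.
Proof.
move=> cS Ss cU U0.
have fU := haar_compact_fin_num haar_mu cU.
have mU := compact_measurable_borel hG cU.
have mUS := compact_measurable_borel hG (set_mulg_compact cU cS).
have mUs := compact_measurable_borel hG
  (set_mulg_compact cU (@compact_set1 _ s)).
rewrite lee_pdivlMr_fin//.
suff : ((d s)%:E * mu U <= mu (set_mulg U S `\` U) + mu U)%E.
  by rewrite -(fineK fU) -!EFinM mulrBl mul1r EFinB -leeBlDr.
rewrite -(modular_Delta s mU).
apply: (@le_trans _ _ (mu (set_mulg U S `\` U `|` U))).
  apply: le_measure; rewrite ?inE//.
    by apply: measurableU => //; exact: measurableD.
  move=> x [u Uu [_ -> <-]].
  have [|nU] := pselect (U (u * s)%g); first by right.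
  by left; split => //; exists u => //; exists s.
by apply: measureU2 => //; exact: measurableD.
Qed.

Lemma boundary_growth S U (eta : R) : compact S -> S 1%g -> compact U ->
  ((0 < mu U)%E -> (eta%:E <= mu (set_mulg U S `\` U) / mu U)%E) ->
  ((1 + eta)%:E * mu U <= mu (set_mulg U S))%E.
Proof.
move=> cS S1 cU etaU.
have fU := haar_compact_fin_num haar_mu cU.
have mU := compact_measurable_borel hG cU.
have mUS := compact_measurable_borel hG (set_mulg_compact cU cS).
have [U0|U0] := eqVneq (mu U) 0%E; first by rewrite U0 mule0.
have {}U0 : (0 < mu U)%E by rewrite lt0e U0 measure_ge0.
have := etaU U0; rewrite lee_pdivlMr_fin// => H.
have UUS : U `<=` set_mulg U S.
  by move=> u Uu; exists u => //; exists 1%g => //; exact: mulg1.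
rewrite -(setDUK UUS) measureU//; last 2 first.
- exact: measurableD.
- by rewrite setDIK.
by rewrite EFinD muleDl// mul1e leeD2l.
Qed.

Lemma folner_constant_ge0 : (0 <= folner_constant mu)%E.
Proof.
apply: le_ereal_inf_tmp => _ [S _ <-]; apply: le_ereal_inf_tmp => _ [U _ <-].
by rewrite mule_ge0// inve_ge0.
Qed.

Lemma folner_constant_small_modular :
  ~ unimodular Delta -> folner_constant mu = 0%E ->
  forall e : R, 0 < e -> exists h, 1 < d h < 1 + e.
Proof.
move=> nu fol0 e e0.
have : (folner_constant mu < e%:E)%E by rewrite fol0 lte_fin.
move=> /ereal_inf_lt[_ [S [cS symS gS] <-]] /ereal_inf_lt[_ [U [cU U0] <-] Ue].
have [s Ss ds1] : exists2 s, S s & 1 < d s.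
  have [s Ss] := generating_modular gS nu.
  rewrite neq_lt => /orP[ds|ds]; last by exists s.
  exists s^-1%g; first by rewrite -symS; exists s.
  by rewrite dV invf_gt1// modular_gt0.
exists s; rewrite ds1/= -ltrBlDl -lte_fin.
exact: le_lt_trans (modular_boundary cS Ss cU U0) Ue.
Qed.

(** If the constant were at least some [eta > 0], every compact [U] would satisfy
[(1 + eta) mu U <= mu (US)]. With [q = 1 + eta / 3] and amenability constant
[eta / 3 / q], [growth_transfer] would bound [1 + eta] by
[q (1 + eta / 3 / q) = 1 + 2 eta / 3]. *)
Lemma dense_folner_constant : totally_disconnected [set: G] ->
  locally_compact [set: G] -> compactly_generated G -> amenable mu ->
  dense (range Delta) -> folner_constant mu = 0%E.
Proof.
move=> tdG lcG cgG amG dD; apply/eqP; rewrite eq_le folner_constant_ge0 andbT.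
rewrite leNgt; apply/negP => fol0.
have [eta eta0 etaF] :
    exists2 eta : R, 0 < eta & (eta%:E <= folner_constant mu)%E.
  move: fol0; case: (folner_constant mu) => [r r0||//]; first by exists r.
  by move=> _; exists 1 => //; exact: leey.
have [V [cV oV gV]] := compact_open_subgroup hG tdG lcG.
pose q := 1 + eta / 3; have q1 : 1 < q by rewrite /q; lra.
have q0 : 0 < q by lra.
have [S [[cS symS gS] [VS VSS SVS Sq]]] : exists S,
    [/\ compact S, symmetric_set S & generating S] /\
    [/\ V `<=` S, set_mulg V S `<=` S, set_mulg S V `<=` S &
       forall s, S s -> d s <= q].
  apply: (small_generating_set gV oV cV cgG).
  have [h /andP[h1 hq]] := dense_modular_small dD q1.
  by exists h; rewrite h1 ltW.
have V1 : V 1%g by exact: set_group_closed1.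
have growth U : compact U -> ((1 + eta)%:E * mu U <= mu (set_mulg U S))%E.
  move=> cU; apply: boundary_growth => //; first exact: VS.
  move=> U0; apply: (le_trans etaF).
  apply: (@le_trans _ _ (ereal_inf [set (mu (set_mulg U S `\` U) / mu U)%E |
      U in [set U : set G | compact U /\ (0 < mu U)%E]])).
    by apply: ereal_inf_lbound; exists S.
  by apply: ereal_inf_lbound; exists U.
have eps0 : 0 < eta / 3 / q by rewrite !divr_gt0.
have [U [cU U0]] := amG S cS _ eps0.
have fU := haar_compact_fin_num haar_mu cU.
rewrite lee_pdivrMr_fin// => SU.
have := growth_transfer cV oV gV cS VS symS VSS SVS Sq q0 cU growth.
have cVU := set_mulg_compact cV cU.
have UVU : (mu U <= mu (set_mulg V U))%E.
  apply: le_measure; rewrite ?inE; try exact: compact_measurable_borel.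
  by move=> u Uu; exists 1%g => //; exists u => //; exact: mul1g.
have fVU := haar_compact_fin_num haar_mu cVU.
have VU0 := lt_le_trans U0 UVU.
apply/negP; rewrite -ltNge.
apply: (@le_lt_trans _ _ (q%:E * ((1 + eta / 3 / q)%:E * mu (set_mulg V U)))%E).
  rewrite lee_pmul2l// ?lte_fin//; apply: (le_trans SU).
  by rewrite lee_pmul2l// lte_fin; lra.
rewrite muleA -EFinM lte_pmul2r// lte_fin mulrDr mulr1 [q * _]mulrC.
rewrite divfK ?gt_eqF//.
by rewrite /q; lra.
Qed.

End Folner.

Theorem theorem1p7 (R : realType) (G : topologicalGroupType)
    (mu : {measure set (borel G) -> \bar R}) (Delta : G -> Rpos R)
    (G_hausdorff : hausdorff_space G)
    (G_locally_compact : locally_compact [set: G])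
    (G_totally_disconnected : totally_disconnected [set: G])
    (G_compactly_generated : compactly_generated G)
    (mu_haar : left_haar mu)
    (Delta_modular : modular_function mu Delta)
    (G_amenable : amenable mu)
    (G_non_unimodular : ~ unimodular Delta) :
  folner_constant mu = 0%E <-> dense (range Delta).
Proof.
split=> [fol0|].
  apply: (small_modular_dense G_hausdorff mu_haar Delta_modular).
  exact: (folner_constant_small_modular G_hausdorff mu_haar Delta_modular).
exact: (dense_folner_constant G_hausdorff mu_haar Delta_modular).
Qed.
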